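(* Suppose $\mathcal{X}\in\mathbb{C}^{n_1\times\cdots\times n_d}$ satisfies the multidimensional Sylvester equation $$\mathcal{X}\times_1 A^{(1)}+\cdots+\mathcal{X}\times_d A^{(d)}=\mathcal{G},\qquad A^{(k)}\in\mathbb{C}^{n_k\times n_k},\quad \mathcal{G}\in\mathbb{C}^{n_1\times\cdots\times n_d},$$ where the normal matrices $A^{(1)},\dots,A^{(d)}$ are Minkowski singly separated with disjoint sets $E_j$ and $F_j$ for $1\le j\le d$. Then, for a fixed $0<\epsilon<1$, $$p^{\rm ML}_\epsilon(\mathcal{X})\le\sum_{j=1}^d n_jk_j\mu_j+\prod_{j=1}^d k_j\mu_j,\qquad \mathrm{rank}^{\rm ML}(\mathcal{G})=(\mu_1,\dots,\mu_d),$$ where, for $1\le j\le d$, $k_j$ is an integer such that $Z_{k_j}(E_j,F_j)\le\epsilon/\sqrt{d}$.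
   Context: Mode product: $(\mathcal{X}\times_k A)_{i_1,\ldots,i_{k-1},j,i_{k+1},\ldots,i_d}=\sum_{i_k=1}^{n_k}\mathcal{X}_{i_1,\ldots,i_d}A_{j,i_k}$. Frobenius norm: $\|\mathcal{X}\|_F^2=\sum_{i_1,\dots,i_d}|\mathcal{X}_{i_1,\ldots,i_d}|^2$. Orthogonal Tucker format: $\mathcal{Y}\in\mathbb{C}^{n_1\times\cdots\times n_d}$ has multilinear rank at most $(t_1,\ldots,t_d)$ if there are matrices $B^{(k)}\in\mathbb{C}^{n_k\times t_k}$ with orthonormal columns and a core tensor $\mathcal{C}\in\mathbb{C}^{t_1\times\cdots\times t_d}$ with $\mathcal{Y}=\sum_{i_1=1}^{t_1}\cdots\sum_{i_d=1}^{t_d}\mathcal{C}_{i_1,\ldots,i_d}\,B^{(1)}_{i_1}\circ\cdots\circ B^{(d)}_{i_d}$, where $B^{(k)}_i$ is the $i$th column of $B^{(k)}$ and $\circ$ is the vector outer product. Storing such a decomposition takes $\sum_{k=1}^d n_kt_k+\prod_{k=1}^d t_k$ degrees of freedom. The multilinear rank $\mathrm{rank}^{\rm ML}(\mathcal{G})=(\mu_1,\dots,\mu_d)$ has entries $\mu_j=\mathrm{rank}(G_{(j)})$, where the $j$th matricization $G_{(j)}$ is the matrix whose columns are the mode-$j$ fibers of $\mathcal{G}$. For $0<\epsilon<1$, $p^{\rm ML}_\epsilon(\mathcal{X})$ denotes the smallest number of degrees of freedom with which one can store, in orthogonal Tucker format, some tensor $\tilde{\mathcal{X}}$ satisfying $\|\mathcal{X}-\tilde{\mathcal{X}}\|_F\le\epsilon\|\mathcal{X}\|_F$.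 Minkowski singly separated: normal matrices $A^{(1)},\ldots,A^{(d)}$ are Minkowski singly separated if there are disjoint sets $E_j,F_j\subseteq\mathbb{C}$ such that $\Lambda(A^{(j)})\subseteq E_j$ and $-\big(\sum_{k=1,k\ne j}^d\Lambda(A^{(k)})\big)\subseteq F_j$ for $1\le j\le d$, where $\Lambda(\cdot)$ denotes the spectrum and set sums are Minkowski sums. Zolotarev number: for disjoint sets $E,F\subseteq\mathbb{C}$ and an integer $k\ge0$, $$Z_k(E,F)=\inf_{r\in\mathcal{R}_{k,k}}\frac{\sup_{z\in E}|r(z)|}{\inf_{z\in F}|r(z)|},$$ where $\mathcal{R}_{k,k}$ is the set of irreducible rational functions $p/q$ with polynomials $p,q$ of degree at most $k$. *)

(* Defs.v *)
From HB Require Import structures.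
From mathcomp Require Import all_boot all_order all_algebra.
From mathcomp Require Import spectral complex.
From mathcomp Require Import boolp classical_sets reals constructive_ereal ereal.

Set Implicit Arguments.
Unset Strict Implicit.
Unset Printing Implicit Defensive.

Import Order.TTheory GRing.Theory Num.Theory ComplexField.Normc.

Local Open Scope classical_set_scope.
Local Open Scope ring_scope.
Local Open Scope sesquilinear_scope.

Notation multi_index n := {dffun forall k, 'I_(n k)}.
Notation tensor R n := {ffun multi_index n -> R[i]}.

Section Tensors.
Variables (R : realType) (d : nat).
Implicit Types (n t : 'I_d -> nat).

Definition subst_index n (i : multi_index n) (k : 'I_d) (a : 'I_(n k)) :
  multi_index n := [ffun l => dfwith i a l].

(* Only square factors occur in the Sylvester equation, so the mode product
   keeps the dimensions. *)
Definition mode_prod n (X : tensor R n) (k : 'I_d) (A : 'M[R[i]]_(n k)) :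
  tensor R n :=
  [ffun j : multi_index n => \sum_(a < n k) X (subst_index j a) * A (j k) a].

Definition frobenius n (X : tensor R n) : R :=
  Num.sqrt (\sum_i normc (X i) ^+ 2).

Definition outer n (v : forall k, 'cV[R[i]]_(n k)) : tensor R n :=
  [ffun i : multi_index n => \prod_k v k (i k) 0].

Definition tucker n t (C : tensor R t) (B : forall k, 'M[R[i]]_(n k, t k)) :
  tensor R n :=
  [ffun i : multi_index n => \sum_(a : multi_index t) C a * outer (fun k => col (a k) (B k)) i].

Definition mlrank_le n (Y : tensor R n) t :=
  exists (B : forall k, 'M[R[i]]_(n k, t k)) (C : tensor R t),
    (forall k, (B k)^t* *m B k = 1%:M) /\ Y = tucker C B.

Definition tucker_dof n t : nat := (\sum_k n k * t k + \prod_k t k)%N.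

Definition approx_dof (eps : R) n (X : tensor R n) (m : nat) :=
  exists t (Y : tensor R n),
    [/\ mlrank_le Y t, frobenius (X - Y) <= eps * frobenius X
      & m = tucker_dof n t].

Lemma tucker_id n (X : tensor R n) : X = tucker X (fun k => 1%:M).
Proof.
apply/ffunP => i; rewrite ffunE (bigD1 i) //= [X in _ + X]big1 => [|a ai].
  rewrite addr0 ffunE big1 ?mulr1 // => k _.
  by rewrite !mxE eqxx.
suff [k kai] : exists k, a k != i k.
  by rewrite ffunE (bigD1 k) //= !mxE eq_sym (negPf kai) mul0r mulr0.
apply/existsP; apply: contraNT ai; rewrite negb_exists => /forallP ai.
by apply/eqP/ffunP => k; apply/eqP; rewrite -[_ == _]negbK ai.
Qed.

Lemma approx_dof_exists (eps : R) n (X : tensor R n) :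
  0 < eps -> exists m, `[< approx_dof eps X m >].
Proof.
move=> eps_gt0; exists (tucker_dof n n); apply/asboolP; exists n, X; split => //.
  exists (fun k => 1%:M), X; split=> [k|]; last exact: tucker_id.
  by rewrite trmx1 map_mx1 mulmx1.
rewrite subrr [leLHS](_ : _ = 0) ?mulr_ge0 ?sqrtr_ge0 ?ltW //.
by rewrite /frobenius big1 ?sqrtr0 // => i _; rewrite ffunE normc0 expr0n.
Qed.

Definition pML (eps : R) (eps_gt0 : 0 < eps) n (X : tensor R n) : nat :=
  ex_minn (approx_dof_exists X eps_gt0).

Definition rest_index n (j : 'I_d) :=
  {dffun forall k : {k : 'I_d | k != j}, 'I_(n (val k))}.

(* The multi-index with entry a at position j and entries c elsewhere. *)
Definition insert_index n (j : 'I_d) (a : 'I_(n j)) (c : rest_index n j) :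
  multi_index n :=
  [ffun k => match boolP (k == j) with
             | AltTrue kj => cast_ord (congr1 n (esym (eqP kj))) a
             | AltFalse kj => c (exist _ k kj)
             end].

Definition matricization n (X : tensor R n) (j : 'I_d) :
  'M[R[i]]_(n j, #|{: rest_index n j}|) :=
  \matrix_(a, c) X (insert_index a (enum_val c)).

Definition mlrank n (X : tensor R n) : 'I_d -> nat :=
  fun j => \rank (matricization X j).

End Tensors.

Arguments mode_prod {R d n} X k A.

Section Separation.
Variables (R : realType) (d : nat).

Definition spectrum m (A : 'M[R[i]]_m) : set R[i] := [set z | eigenvalue A z].

Definition minkowski_sum (P : pred 'I_d) (S : 'I_d -> set R[i]) : set R[i] :=
  [set \sum_(k | P k) w k | w in [set w | forall k, P k -> S k (w k)]].

Definition singly_separated_by (n : 'I_d -> nat)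
    (A : forall k, 'M[R[i]]_(n k)) (E F : 'I_d -> set R[i]) :=
  forall j, [/\ E j `&` F j = set0, spectrum (A j) `<=` E j
    & -%R @` minkowski_sum (fun k => k != j) (fun k => spectrum (A k))
        `<=` F j].

End Separation.

Section Zolotarev.
Variable R : realType.
Implicit Types (p q : {poly R[i]}) (E F : set R[i]).
Local Open Scope ereal_scope.

Definition irreducible_ratfun (k : nat) p q :=
  [&& q != 0%R, coprimep p q, (size p <= k.+1)%N & (size q <= k.+1)%N].

(* |p(z) / q(z)|, which is +oo at the poles: in \bar R, c / 0 = +oo for c > 0,
   and p, q have no common root. *)
Definition ratfun_norm p q (z : R[i]) : \bar R :=
  (normc p.[z])%:E / (normc q.[z])%:E.

Definition sup_ratfun p q E : \bar R := ereal_sup [set ratfun_norm p q z | z in E].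
Definition inf_ratfun p q F : \bar R := ereal_inf [set ratfun_norm p q z | z in F].

(* The side condition discards the functions, such as 0, whose quotient is
   0 / 0 or +oo / +oo (a product 0 * +oo is 0 in \bar R). *)
Definition zolotarev (k : nat) E F : \bar R :=
  ereal_inf [set x | exists p q,
    [/\ irreducible_ratfun k p q, sup_ratfun p q E *? (inf_ratfun p q F)^-1
      & x = sup_ratfun p q E / inf_ratfun p q F]].

End Zolotarev.

(* Main.v *)
(* Diagonalizing every A^(k) by a unitary change of basis turns the Sylvester
   equation into (al_a - be_c) x_{ac} = g_{ac} for each matricization, where al_a
   lies in E_j and be_c in F_j. For r = p/q of degree at most k_j, the matrix with
   entries (1 - r(al_a) / r(be_c)) x_{ac} has rank at most k_j mu_j, because
   al - be divides q(al) p(be) - p(al) q(be) with a quotient that is a sum of k_j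
   separated terms, and it approximates x up to the factor sup_E |r| / inf_F |r|.
   The infimum defining the Zolotarev number need not be attained, so these
   competitors are compared with one fixed optimal projection of rank at most
   k_j mu_j, given by Ky Fan's principle. Applying the projections in all d modes
   adds up the d squared errors, each at most eps^2 / d. *)
Require Import Defs.
From HB Require Import structures.
From mathcomp Require Import all_boot all_order all_algebra.
From mathcomp Require Import spectral complex.
From mathcomp Require Import boolp classical_sets reals constructive_ereal ereal.
From mathcomp Require Import ring.

Set Implicit Arguments.
Unset Strict Implicit.
Unset Printing Implicit Defensive.

Import Order.TTheory GRing.Theory Num.Theory ComplexField.Normc.

Local Open Scope classical_set_scope.
Local Open Scope ring_scope.
Local Open Scope sesquilinear_scope.

(** * Weighted selection, the combinatorial half of Ky Fan's principle *)

(** Fractional weights cannot beat a 0/1 choice: [S] is a set of maximal total weight among those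
    with at most [K] elements, and an exchange argument compares it with any [w]. Below, [lam] holds
    eigenvalues and [w] the squared row norms of an orthonormal frame. *)
Lemma knapsack (R : realDomainType) (I : finType) (K : nat) (lam : I -> R) :
    (forall i, 0 <= lam i) ->
  exists2 S : {set I}, (#|S| <= K)%N &
    forall w : I -> R, (forall i, 0 <= w i <= 1) -> \sum_i w i <= K%:R ->
      \sum_i lam i * w i <= \sum_(i in S) lam i.
Proof.
move=> lam_ge0.
pose small (S : {set I}) := (#|S| <= K)%N.
have small0 : small finset.set0 by rewrite /small cards0.
case: (Order.TotalTheory.arg_maxP (fun S : {set I} => \sum_(i in S) lam i) small0)
  => S; rewrite /small => SK Smax.
exists S => // w w01 wK.
(* [tau] separates the values of [lam] inside [S] from those outside; it is 0
   when [S] has fewer than [K] elements. *)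
have [tau [tau_ge0 tauS tauNS tauK]] : exists tau, [/\ 0 <= tau,
    forall i, i \in S -> tau <= lam i, forall i, i \notin S -> lam i <= tau
    & tau * K%:R = tau * #|S|%:R].
  have [i0 i0S | SI] := pickP (predC (mem S)); last first.
    exists 0; split=> // [i|]; last by rewrite !mul0r.
    by move/(_ i): SI => /= ->.
  case: (@Order.TotalTheory.arg_maxP _ _ _ i0 (predC (mem S)) lam i0S)
    => {i0S} i1 /= i1S i1max.
  exists (lam i1).
  (* Here [i1] carries the largest value outside [S]. If [S] has room, adding [i1] cannot increase
     the maximum, so its value is 0; if [S] is full, swapping [i1] for some [i] in [S] cannot
     increase it either. *)
  have [SltK|] := ltnP #|S| K.
    have := Smax (i1 |: S)%SET; rewrite cardsU1 i1S add1n => /(_ SltK).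
    rewrite /Order.ge /= big_setU1 //= gerDr => lam1.
    have -> : lam i1 = 0 by apply/le_anti; rewrite lam1 lam_ge0.
    split=> // [i iS|]; last by rewrite !mul0r.
    by apply: le_trans lam1; apply: i1max.
  move=> KS; have {KS SK} SK : #|S| = K by apply/anti_leq; rewrite SK KS.
  split=> // [i iS|]; last by rewrite SK.
  have := Smax (i1 |: (S :\ i))%SET.
  rewrite cardsU1 !inE (negPf i1S) andbF add1n -SK (cardsD1 i S) iS.
  move=> /(_ (leqnn _)); rewrite /Order.ge /= big_setU1 ?inE ?(negPf i1S) ?andbF //=.
  by rewrite (big_setD1 i iS) /= lerD2r.
rewrite -subr_le0 [X in _ - X]big_mkcond -sumrB.
(* Termwise comparison: inside [S] the factor [w i - 1] is nonpositive and [lam i] is at least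
   [tau]; outside, [w i] is nonnegative and [lam i] at most [tau]. *)
apply: (@le_trans _ _ (\sum_i tau * (w i - (i \in S)%:R))).
  apply: ler_sum => i _; have /andP[w0 w1] := w01 i.
  case: ifPn => iS; rewrite ?subr0.
    rewrite -{2}[lam i]mulr1 -mulrBr -subr_ge0 -mulrBl mulr_le0 //.
      by rewrite subr_le0 tauS.
    by rewrite subr_le0.
  by rewrite ler_wpM2r ?tauNS.
rewrite -mulr_sumr sumrB mulrBr -natr_sum subr_le0.
rewrite (_ : (\sum_i (i \in S) = #|S|)%N); last by rewrite -sum1_card [RHS]big_mkcond.
by rewrite -tauK ler_wpM2l.
Qed.

(** * Frobenius norms of matrices and optimal projections *)

Section FrobeniusMatrix.
Variable R : realType.
Local Notation C := R[i].

Lemma sqr_normcE (z : C) : (normc z ^+ 2)%:C%C = z * z^*.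
Proof. by rewrite rmorphXn -normCK. Qed.

Definition mxsq m n (A : 'M[C]_(m, n)) : R := \sum_i \sum_j normc (A i j) ^+ 2.

Lemma mxsq_ge0 m n (A : 'M[C]_(m, n)) : 0 <= mxsq A.
Proof. by do 2![apply: sumr_ge0 => ? _]; rewrite sqr_ge0. Qed.

Lemma mxsqE m n (A : 'M[C]_(m, n)) : (mxsq A)%:C%C = \tr (A *m A^t*).
Proof.
rewrite rmorph_sum; apply: eq_bigr => i _; rewrite rmorph_sum mxE.
by apply: eq_bigr => j _; rewrite /= sqr_normcE !mxE.
Qed.

Lemma mxsq_pythagoras m n p (B : 'M[C]_(m, n)) (e : 'M_(m, p)) (w : 'M_(n, p)) :
  B^t* *m B = 1%:M -> B^t* *m e = 0 -> mxsq (e + B *m w) = mxsq e + mxsq w.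
Proof.
move=> BB Be; apply: complexI; rewrite rmorphD /= !mxsqE.
have eB : e^t* *m B = 0.
  by rewrite -[B]trmxCK -map_mxM -trmx_mul Be trmx0 map_mx0.
rewrite linearD /= map_mxD trmx_mul map_mxM mulmxDr !mulmxDl !linearD /=.
have -> : \tr (B *m w *m e^t*) = 0.
  by rewrite mxtrace_mulC mulmxA eB mul0mx mxtrace0.
have -> : \tr (e *m (w^t* *m B^t*)) = 0.
  by rewrite mxtrace_mulC -mulmxA Be mulmx0 mxtrace0.
have -> : \tr (B *m w *m (w^t* *m B^t*)) = \tr (w *m w^t*).
  by rewrite mxtrace_mulC -!mulmxA [B^t* *m _]mulmxA BB mul1mx mxtrace_mulC.
by rewrite addr0 add0r.
Qed.

(** Pythagoras for the parts of [x - B *m z] orthogonal to and inside the range of [B]. Hence the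
    orthogonal projection of [x] is its best approximation with columns in that range. *)
Lemma mxsq_sub_range m n p (B : 'M[C]_(m, n)) (x : 'M_(m, p)) (z : 'M_(n, p)) :
    B^t* *m B = 1%:M ->
  mxsq (x - B *m z) = mxsq (x - B *m B^t* *m x) + mxsq (B^t* *m x - z).
Proof.
move=> BB; rewrite -(mxsq_pythagoras _ BB).
  by rewrite mulmxBr mulmxA addrA subrK.
by rewrite mulmxBr !mulmxA BB mul1mx subrr.
Qed.

Lemma mxsq_sub_proj m n p (B : 'M[C]_(m, n)) (x : 'M_(m, p)) :
    B^t* *m B = 1%:M ->
  mxsq (x - B *m B^t* *m x) = mxsq x - mxsq (B^t* *m x).
Proof.
move=> BB; have := mxsq_sub_range x 0 BB.
by rewrite mulmx0 !subr0 => ->; rewrite addrK.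
Qed.

(** Gram-Schmidt on a column basis of [y]; the transposes appear because [schmidt] works on rows. *)
Lemma orthonormal_range m p (y : 'M[C]_(m, p)) :
  exists (B : 'M[C]_(m, \rank y)) (z : 'M_(\rank y, p)),
    B^t* *m B = 1%:M /\ y = B *m z.
Proof.
pose S := schmidt (col_base y)^T.
have /unitarymxP SS : S \is unitarymx by apply/schmidt_unitarymx/rank_leq_row.
have /submxP[D yS] := schmidt_sub (col_base y)^T.
exists S^T, (D^T *m row_base y); split.
  have SE : S^T = map_mx Num.conj (S^t*) by apply/matrixP=> i j; rewrite !mxE conjCK.
  by rewrite trmxK [X in _ *m X]SE -map_mxM SS map_mx1.
by rewrite mulmxA -trmx_mul -yS trmxK mulmx_base.
Qed.

(* Ky Fan's maximum principle: the span of the top [K] eigenvectors of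
   [x *m x^t*] is a best subspace, whatever the competitor [y]. *)
Lemma best_low_rank_proj m p (K : nat) (x : 'M[C]_(m, p)) :
  exists (t : nat) (B : 'M[C]_(m, t)),
    [/\ (t <= K)%N, B^t* *m B = 1%:M &
      forall y, (\rank y <= K)%N -> mxsq (x - B *m B^t* *m x) <= mxsq (x - y)].
Proof.
pose H := x *m x^t*; pose V := spectralmx H.
have V_unitary : V \is unitarymx by apply: spectral_unitarymx.
have VV : V *m V^t* = 1%:M by apply/unitarymxP.
have VV' : V^t* *m V = 1%:M by apply: mulmx1C.
have Hnormal : H \is normalmx.
  by apply/normalmxP; rewrite /H trmx_mul map_mxM trmxCK.
have /orthomx_spectralP := Hnormal; rewrite -/V invmx_unitary //.
set L := spectral_diag H => HE.
pose lam a := \sum_c normc ((V *m x) a c) ^+ 2.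
have lam_ge0 a : 0 <= lam a by apply: sumr_ge0 => c _; rewrite sqr_ge0.
(* In eigenvector coordinates the rows of [x] are pairwise orthogonal, and their squared norms [lam]
   are the eigenvalues of [H]. *)
have VxE : (V *m x) *m (V *m x)^t* = diag_mx L.
  rewrite trmx_mul map_mxM -mulmxA [x *m _]mulmxA -/H HE.
  by rewrite !mulmxA VV mul1mx -mulmxA VV mulmx1.
have lamE a : (lam a)%:C%C = L 0 a.
  have := congr1 (fun M : 'M_m => M a a) VxE.
  rewrite /= [RHS]mxE eqxx mulr1n => <-; rewrite rmorph_sum mxE.
  by apply: eq_bigr => c _; rewrite /= sqr_normcE !mxE.
have [S SK Smax] := knapsack K lam_ge0.
pose B : 'M[C]_(m, #|S|) := colsub enum_val (V^t*).
have BtE : B^t* = rowsub enum_val V.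
  by apply/matrixP => s a; rewrite !mxE conjCK.
have BB : B^t* *m B = 1%:M.
  rewrite BtE; apply/matrixP => s s'.
  have := congr1 (fun M : 'M_m => M (enum_val s) (enum_val s')) VV.
  rewrite !mxE (inj_eq enum_val_inj) => <-.
  by apply: eq_bigr => a _; rewrite !mxE.
exists #|S|, B; split=> // y yK.
(* Replacing the competitor by the projection of [x] onto its column space only lowers the error, so
   it suffices to compare the norms kept by two projections. *)
have [B0 [z [BB0 ->]]] := orthonormal_range y.
rewrite (mxsq_sub_range _ _ BB0).
apply: (@le_trans _ _ (mxsq (x - B0 *m B0^t* *m x))); last first.
  by rewrite lerDl mxsq_ge0.
rewrite !mxsq_sub_proj // lerD2l lerN2.
have -> : mxsq (B^t* *m x) = \sum_(a in S) lam a.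
  rewrite big_enum_val BtE; apply: eq_bigr => s _; apply: eq_bigr => c _.
  by rewrite !mxE; congr (normc _ ^+ 2); apply: eq_bigr => a _; rewrite !mxE.
(* [D] is the competing frame in eigenvector coordinates. The norm it keeps is the [lam]-average
   with weights [w], its squared row norms. *)
have [D DE] : exists D, D = V *m B0 by exists (V *m B0).
have DD : D^t* *m D = 1%:M.
  by rewrite DE trmx_mul map_mxM -mulmxA [V^t* *m _]mulmxA VV' mul1mx.
pose w a := \sum_s normc (D a s) ^+ 2.
have -> : mxsq (B0^t* *m x) = \sum_a lam a * w a.
  apply: complexI; rewrite mxsqE rmorph_sum /=.
  have -> : B0^t* *m x = D^t* *m (V *m x).
    by rewrite DE trmx_mul map_mxM !mulmxA -[_ *m _ *m V]mulmxA VV' mulmx1.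
  rewrite trmx_mul map_mxM trmxCK mulmxA -[_ *m _ *m _^t*]mulmxA VxE.
  rewrite mxtrace_mulC mulmxA; apply: eq_bigr => a _.
  rewrite rmorphM /= lamE mul_mx_diag mxE mulrC; congr (_ * _).
  rewrite rmorph_sum mxE; apply: eq_bigr => s _.
  by rewrite /= sqr_normcE !mxE.
(* Each [w a] is the squared norm of the compression by [D^t*] of a unit vector, hence at most 1;
   the total is the trace of [D^t* *m D], the number of columns of [D]. *)
apply: Smax => [a|].
  rewrite sumr_ge0 /= => [|s _]; last by rewrite sqr_ge0.
  have -> : w a = mxsq (D^t* *m delta_mx a (0 : 'I_1)).
    apply: eq_bigr => s _; rewrite big_ord1 -colE !mxE.
    by congr (_ ^+ 2); case: (D a s) => u v /=; rewrite sqrrN.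
  have <- : mxsq (delta_mx a (0 : 'I_1) : 'M[C]_(m, 1)) = 1.
    rewrite /mxsq (bigD1 a) //= big_ord1 mxE !eqxx andbb normc1 expr1n big1 ?addr0 //.
    by move=> b /negPf ba; rewrite big_ord1 mxE ba normc0 expr0n.
  by rewrite -subr_ge0 -mxsq_sub_proj // mxsq_ge0.
have -> : \sum_a w a = (\rank y)%:R; last by rewrite ler_nat.
apply: complexI; rewrite -/(mxsq D) mxsqE mxtrace_mulC DD mxtrace1.
by rewrite rmorph_nat.
Qed.

End FrobeniusMatrix.

(** * From Zolotarev numbers to low-rank approximation *)

Lemma normc_nneg (R : realType) (z : R[i]) : 0 <= normc z.
Proof. by case: z => u v; apply: sqrtr_ge0. Qed.

(** A finite quotient of extended reals, not of an undefined form, forces a finite supremum on [E]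
    and a nonzero infimum on [F]: no pole in [E], no zero in [F]. Poles in [F] remain possible,
    hence the form [q.[b] / p.[b]] for the reciprocal. *)
Lemma zolotarev_lt (R : realType) (k : nat) (E F : set R[i]) (c : R) :
    (zolotarev k E F < c%:E)%E ->
  exists p q : {poly R[i]}, [/\ (size p <= k.+1)%N, (size q <= k.+1)%N &
    forall a b, E a -> F b -> [/\ q.[a] != 0, p.[b] != 0 &
      normc (p.[a] / q.[a] * (q.[b] / p.[b])) <= c]].
Proof.
case/ereal_inf_lt => x [p [q [/and4P[_ pq_coprime szp szq]]]].
set S := sup_ratfun p q E; set I := inf_ratfun p q F.
move=> SI_def -> SI_lt; exists p, q; split=> // a b Ea Fb.
have ratfun_ge0 z : (0 <= ratfun_norm p q z)%E.
  by rewrite /ratfun_norm mule_ge0 ?inve_ge0 ?lee_fin ?normc_nneg.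
have S_ge : (ratfun_norm p q a <= S)%E by apply: ereal_sup_ubound; exists a.
have I_le : (I <= ratfun_norm p q b)%E by apply: ereal_inf_lbound; exists b.
have I_ge0 : (0 <= I)%E by apply: le_ereal_inf_tmp => _ [z _ <-].
have S_ge0 : (0 <= S)%E by apply: le_trans S_ge.
have nS_infty : S != +oo%E.
  apply/eqP => SE; move: SI_def SI_lt; rewrite SE mule_defE eqxx andbT orbC negb_or.
  case/andP => I0 _; rewrite gt0_mulye //.
  by rewrite lt_def I0 inve_ge0.
have nI0 : I != 0%E.
  apply/eqP => IE; move: SI_def SI_lt; rewrite IE inve0 mule_defE eqxx andbT negb_or.
  case/andP => S0 _; rewrite gt0_muley //.
  by rewrite lt_def S0.
have normc_gt0 z : z != 0 -> 0 < normc z :> R.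
  move=> z0; rewrite lt_def normc_nneg andbT.
  by apply: contraNneq z0 => /eq0_normc ->.
have qa : q.[a] != 0.
  apply: contraNN nS_infty => /eqP qa0; rewrite -leye_eq; apply: le_trans S_ge.
  have pa0 : p.[a] != 0.
    by rewrite coprimep_sym in pq_coprime; apply: coprimep_root pq_coprime _; apply/eqP.
  by rewrite /ratfun_norm qa0 normc0 inve0 gt0_muley // lte_fin normc_gt0.
have pb : p.[b] != 0.
  apply: contraNN nI0 => /eqP pb0; rewrite eq_le I_ge0 andbT.
  by apply: le_trans I_le _; rewrite /ratfun_norm pb0 normc0 mul0e.
split=> //; rewrite -lee_fin; apply: le_trans (ltW SI_lt).
rewrite normcM EFinM; apply: lee_pmul; rewrite ?lee_fin ?normc_nneg //.
  apply: le_trans S_ge; rewrite /ratfun_norm inver.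
  have -> : (normc q.[a] == 0) = false by apply/negbTE; rewrite gt_eqF // normc_gt0.
  by rewrite normcM normcV.
apply: (@le_trans _ _ (ratfun_norm p q b)^-1%E); last first.
  by rewrite lee_pV2 // inE.
(* At a pole in [F] the norm is +oo, and its inverse 0 agrees with [q.[b] / p.[b]]. *)
rewrite /ratfun_norm inver; case: eqP => [qb0|/eqP qb0].
  by rewrite gt0_muley ?lte_fin ?normc_gt0 // invey normcM qb0 mul0r.
rewrite -EFinM inver mulf_eq0 invr_eq0 (negPf qb0) orbF gt_eqF ?normc_gt0 //.
by rewrite invf_div lee_fin normcM normcV.
Qed.

Lemma rank_sum_mulmx (K : fieldType) (m n p q : nat) (g : 'M[K]_(m, n)) (k : nat)
    (L : 'I_k -> 'M_(p, m)) (W : 'I_k -> 'M_(n, q)) :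
  (\rank (\sum_i L i *m g *m W i)%R <= k * \rank g)%N.
Proof.
apply: (@leq_trans (\sum_(i < k) \rank g)); last by rewrite sum_nat_const card_ord.
elim/big_ind2: _ => [|u M v N uM vN|i _]; first by rewrite mxrank0.
  by apply: leq_trans (leq_add uM vN); apply: mxrank_add.
by apply: leq_trans (mxrankM_maxl _ _) (mxrankM_maxr _ _).
Qed.

(** The divided difference of [p] has degree below [k] in [u], so sorting it by powers of [u] leaves
    [k] separated terms. This count is the factor [k] in the rank bound. *)
Lemma horner_divided_diff (K : comNzRingType) (k : nat) (p : {poly K}) :
    (size p <= k.+1)%N ->
  exists P : 'I_k -> {poly K}, forall u v,
    p.[u] - p.[v] = (u - v) * \sum_(i < k) u ^+ i * (P i).[v].
Proof.
move=> szp.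
exists (fun i => \sum_(a < k.+1 | (i < a)%N) p`_a *: 'X^(a.-1 - i)) => u v.
rewrite !(horner_coef_wide _ szp) -sumrB.
transitivity (\sum_(a < k.+1) \sum_(i < k | (i < a)%N)
    (u - v) * (u ^+ i * (p`_a * v ^+ (a.-1 - i)))).
  apply: eq_bigr => a _; rewrite -mulr_sumr -mulrBr -opprB subrXX -mulNr opprB.
  rewrite mulrCA; congr (_ * _); rewrite mulr_sumr.
  rewrite (big_ord_widen k (fun i => p`_a * (v ^+ (a.-1 - i) * u ^+ i))) ?leq_ord //.
  by apply: eq_bigr => i _; ring.
rewrite (exchange_big_dep xpredT) //= mulr_sumr; apply: eq_bigr => i _.
rewrite horner_sum -!mulr_sumr; congr (_ * (_ * _)).
by apply: eq_bigr => a _; rewrite hornerZ hornerXn.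
Qed.

(* With [al] and [be] the eigenvalues, [y] is [x - r(A) x r(B)^-1] written in
   eigenvector coordinates. *)
Lemma zolotarev_low_rank (R : realType) (k m p : nat) (E F : set R[i]) (c : R)
    (al : 'I_m -> R[i]) (be : 'I_p -> R[i]) (x g : 'M[R[i]]_(m, p)) :
    (forall a, E (al a)) -> (forall b, F (be b)) ->
    (zolotarev k E F < c%:E)%E ->
    (forall a b, (al a - be b) * x a b = g a b) ->
  exists2 y : 'M[R[i]]_(m, p), (\rank y <= k * \rank g)%N &
    forall a b, normc ((x - y) a b) <= c * normc (x a b).
Proof.
move=> Eal Fbe /zolotarev_lt[P [Q [szP szQ PQ]]] xg.
have [DP DPE] := horner_divided_diff szP.
have [DQ DQE] := horner_divided_diff szQ.
(* Writing Q(u)P(v) - P(u)Q(v) as (Q(u) - Q(v))P(v) - (P(u) - P(v))Q(v) exposes divided differences: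
   [L i] holds the factor in u = al and [W i] the factor in v = be, while al - be is absorbed into
   [g]. *)
pose L (i : 'I_k) := diag_mx (\row_a (al a ^+ i / Q.[al a])).
pose W (i : 'I_k) := diag_mx (\row_b
  (((DQ i).[be b] * P.[be b] - (DP i).[be b] * Q.[be b]) / P.[be b])).
exists (\sum_i L i *m g *m W i); first exact: rank_sum_mulmx.
move=> a b; have [Qa Pb PQab] := PQ _ _ (Eal a) (Fbe b).
suff -> : (x - \sum_i L i *m g *m W i) a b =
    x a b * (P.[al a] / Q.[al a] * (Q.[be b] / P.[be b])).
  by rewrite normcM mulrC ler_wpM2r ?normc_nneg.
rewrite [LHS]mxE [X in _ + X]mxE summxE.
have -> : \sum_i (L i *m g *m W i) a b =
    ((Q.[al a] - Q.[be b]) * P.[be b] - (P.[al a] - P.[be b]) * Q.[be b])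
      / Q.[al a] / P.[be b] * x a b.
  rewrite DPE DQE !mulr_sumr !mulr_suml -sumrB !mulr_suml; apply: eq_bigr => i _.
  rewrite /L /W mul_mx_diag mxE mul_diag_mx !mxE -xg; field.
  by rewrite Qa Pb.
rewrite -{1}[x a b]mul1r -mulrBl mulrC; congr (_ * _).
by field; rewrite Qa Pb.
Qed.

Lemma low_rank_proj_of_zolotarev (R : realType) (k m p : nat) (E F : set R[i]) (c : R)
    (al : 'I_m -> R[i]) (be : 'I_p -> R[i]) (x g : 'M[R[i]]_(m, p)) :
    (forall a, E (al a)) -> (forall b, F (be b)) ->
    0 <= c -> (zolotarev k E F <= c%:E)%E ->
    (forall a b, (al a - be b) * x a b = g a b) ->
  exists (t : nat) (B : 'M[R[i]]_(m, t)),
    [/\ (t <= k * \rank g)%N, B^t* *m B = 1%:M &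
      mxsq (x - B *m B^t* *m x) <= c ^+ 2 * mxsq x].
Proof.
move=> Eal Fbe c_ge0 Zc xg.
have [t [B [tk BB Bbest]]] := best_low_rank_proj (k * \rank g) x.
exists t, B; split=> //; set e := mxsq _.
(* Competitors exist only for [eta] strictly above [c], but [B] does not depend on [eta]. *)
have e_le eta : c < eta -> e <= eta ^+ 2 * mxsq x.
  move=> c_lt.
  have [|y rky xy] := zolotarev_low_rank Eal Fbe _ xg (c := eta) (k := k).
    by apply: le_lt_trans Zc _; rewrite lte_fin.
  apply: le_trans (Bbest y rky) _; rewrite /mxsq mulr_sumr; apply: ler_sum => a _.
  rewrite mulr_sumr; apply: ler_sum => b _; rewrite -exprMn.
  by rewrite ler_sqr ?nnegrE ?normc_nneg // mulr_ge0 ?normc_nneg // (le_trans c_ge0) // ltW.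
have e_ge0 : 0 <= e by apply: mxsq_ge0.
have [x0|x_gt0] : mxsq x = 0 \/ 0 < mxsq x.
- have := mxsq_ge0 x; rewrite le_eqVlt => /orP[/eqP <-|]; by [left|right].
- by rewrite x0 mulr0; have := e_le (c + 1); rewrite x0 mulr0 ltrDl; apply.
rewrite leNgt -ltr_pdivlMr //; apply/negP => c_lt.
(* If the claim failed, the relative error [s] would exceed [c], and the midpoint of [c] and [s] as
   [eta] would contradict [e_le]. *)
pose s := Num.sqrt (e / mxsq x).
have sE : s ^+ 2 = e / mxsq x by rewrite sqr_sqrtr // divr_ge0 // ltW.
have cs : c < s by rewrite -ltr_sqr ?nnegrE ?sqrtr_ge0 // sE.
have [c_mid mid_s] := midf_lt cs.
have := e_le _ c_mid; rewrite -ler_pdivrMr // -sE leNgt ltr_sqr ?mid_s //.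
- by rewrite nnegrE (le_trans c_ge0) // ltW.
- by rewrite nnegrE sqrtr_ge0.
Qed.

(** * Algebra of Tucker transforms *)

(** Passing to [fprod] and tagged values reduces distributivity over dependent families to the case
    of one common index type. *)
Lemma prod_sum_dffun (S : comPzSemiRingType) (I : finType) (T : I -> finType)
    (F : forall k, T k -> S) :
  \prod_k \sum_(a : T k) F k a = \sum_(f : {dffun forall k, T k}) \prod_k F k (f k).
Proof.
pose F' k := [ffun a => F k a].
rewrite (reindex (@dffun_of_fprod I T)) /=; last exact/onW_bij/dffun_of_fprod_bij.
transitivity (\sum_(t : fprod T) \prod_k F' k (t k)); last first.
  by apply: eq_bigr => t _; apply: eq_bigr => k _; rewrite !ffunE.
rewrite (big_fprod _ _ F') -(bigA_distr_big_dep _ (fun k j => untag 0 (F' k) j)).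
apply: eq_bigr => k _; transitivity (\sum_(a : T k) F' k a).
  by apply: eq_bigr => a _; rewrite ffunE.
by rewrite (big_tag (fun k => F' k)).
Qed.

Section TensorAlgebra.
Variables (R : realType) (d : nat).
Implicit Types n t u : 'I_d -> nat.

Lemma tuckerE n t (C : tensor R t) (B : forall k, 'M[R[i]]_(n k, t k)) (i : multi_index n) :
  tucker C B i = \sum_a C a * \prod_k B k (i k) (a k).
Proof.
rewrite ffunE; apply: eq_bigr => a _; rewrite ffunE; congr (_ * _).
by apply: eq_bigr => k _; rewrite mxE.
Qed.

Lemma eq_tucker n t (C : tensor R t) (B B' : forall k, 'M[R[i]]_(n k, t k)) :
  (forall k, B k = B' k) -> tucker C B = tucker C B'.
Proof.
move=> BB'; apply/ffunP => i; rewrite !tuckerE; apply: eq_bigr => a _.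
by congr (_ * _); apply: eq_bigr => k _; rewrite BB'.
Qed.

(** Changes of basis, projections and mode products are all expressed through [tucker], so
    compositions reduce to matrix products mode by mode. *)
Lemma tucker_comp n t u (C : tensor R u) (B : forall k, 'M[R[i]]_(t k, u k))
    (B' : forall k, 'M[R[i]]_(n k, t k)) :
  tucker (tucker C B) B' = tucker C (fun k => B' k *m B k).
Proof.
apply/ffunP => i; rewrite !tuckerE.
under eq_bigr => a _ do rewrite tuckerE mulr_suml.
rewrite exchange_big; apply: eq_bigr => b _ /=.
under [X in _ = _ * X]eq_bigr => k _ do rewrite mxE.
rewrite prod_sum_dffun mulr_sumr; apply: eq_bigr => a _.
by rewrite big_split /= -mulrA [X in _ * X]mulrC.
Qed.

Lemma tucker_sum n t (B : forall k, 'M[R[i]]_(n k, t k)) (I : finType) (P : pred I)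
    (C : I -> tensor R t) :
  tucker (\sum_(l | P l) C l) B = \sum_(l | P l) tucker (C l) B.
Proof.
apply/ffunP => i; rewrite sum_ffunE tuckerE.
under eq_bigr => a _ do rewrite sum_ffunE mulr_suml.
by rewrite exchange_big; apply: eq_bigr => l _; rewrite tuckerE.
Qed.

Lemma tuckerB n t (B : forall k, 'M[R[i]]_(n k, t k)) (C C' : tensor R t) :
  tucker (C - C') B = tucker C B - tucker C' B.
Proof.
apply/ffunP => i; rewrite tuckerE [RHS]ffunE [X in _ = _ + X]ffunE !tuckerE -sumrB.
by apply: eq_bigr => a _; rewrite !ffunE mulrBl.
Qed.

Definition tensor_dot n (X Y : tensor R n) : R[i] := \sum_i X i * (Y i)^*.

Definition tensor_sq n (X : tensor R n) : R := \sum_i normc (X i) ^+ 2.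

Lemma tensor_sq_ge0 n (X : tensor R n) : 0 <= tensor_sq X.
Proof. by apply: sumr_ge0 => i _; rewrite sqr_ge0. Qed.

Lemma tensor_sqE n (X : tensor R n) : (tensor_sq X)%:C%C = tensor_dot X X.
Proof. by rewrite rmorph_sum; apply: eq_bigr => i _; rewrite /= sqr_normcE. Qed.

(** Adjoints are taken mode by mode. Isometry for orthonormal factors and orthogonality of
    projections both follow. *)
Lemma tensor_dot_tucker n t (C : tensor R t) (B : forall k, 'M[R[i]]_(n k, t k))
    (Y : tensor R n) :
  tensor_dot (tucker C B) Y = tensor_dot C (tucker Y (fun k => (B k)^t* )).
Proof.
rewrite /tensor_dot; under eq_bigr => i _ do rewrite tuckerE mulr_suml.
rewrite exchange_big; apply: eq_bigr => a _ /=.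
rewrite tuckerE rmorph_sum mulr_sumr; apply: eq_bigr => i _.
rewrite rmorphM rmorph_prod /= -mulrA; congr (_ * _); rewrite mulrC; congr (_ * _).
by apply: eq_bigr => k _; rewrite !mxE conjCK.
Qed.

Lemma tensor_sq_isometry n t (C : tensor R t) (B : forall k, 'M[R[i]]_(n k, t k)) :
  (forall k, (B k)^t* *m B k = 1%:M) -> tensor_sq (tucker C B) = tensor_sq C.
Proof.
move=> BB; apply: complexI; rewrite !tensor_sqE tensor_dot_tucker tucker_comp.
by rewrite (eq_tucker _ BB) -tucker_id.
Qed.

Lemma tensor_sqD_orth n (X Y : tensor R n) :
    tensor_dot X Y = 0 -> tensor_sq (X + Y) = tensor_sq X + tensor_sq Y.
Proof.
move=> XY; have YX : tensor_dot Y X = 0.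
  rewrite -[RHS](rmorph0 Num.conj) -XY /tensor_dot rmorph_sum; apply: eq_bigr => i _.
  by rewrite rmorphM /= conjCK mulrC.
apply: complexI; rewrite rmorphD /= !tensor_sqE.
rewrite -[RHS]addr0 -{1}XY -[RHS]addr0 -{1}YX -!big_split /=.
by apply: eq_bigr => i _; rewrite !ffunE rmorphD /=; ring.
Qed.

(** * Error of projecting in several modes *)

Section ModeProjections.
Variables (n : 'I_d -> nat) (P : forall k, 'M[R[i]]_(n k)).
Hypothesis P_herm : forall k, (P k)^t* = P k.
Hypothesis P_idem : forall k, P k *m P k = P k.

Definition select_modes (s : pred 'I_d) : forall k, 'M[R[i]]_(n k) :=
  fun k => if s k then P k else 1%:M.

Lemma select_modes_herm s k : (select_modes s k)^t* = select_modes s k.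
Proof. by rewrite /select_modes; case: ifP => // _; rewrite trmx1 map_mx1. Qed.

Lemma select_modes_idem s k : select_modes s k *m select_modes s k = select_modes s k.
Proof. by rewrite /select_modes; case: ifP => // _; rewrite mulmx1. Qed.

(** The mode-wise product of the selected projections is itself an orthogonal projection: the first
    summand lies in its kernel, the second in its range. *)
Lemma tensor_sq_proj s (X Z : tensor R n) :
  tensor_sq (X - tucker X (select_modes s) + tucker Z (select_modes s)) =
  tensor_sq (X - tucker X (select_modes s)) + tensor_sq (tucker Z (select_modes s)).
Proof.
apply: tensor_sqD_orth.
have -> : tucker Z (select_modes s) = tucker Z (fun k => (select_modes s k)^t* ).
  by apply: eq_tucker => k; rewrite select_modes_herm.
rewrite -tensor_dot_tucker tuckerB tucker_comp (eq_tucker _ (select_modes_idem s)).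
by rewrite subrr /tensor_dot big1 // => i _; rewrite ffunE mul0r.
Qed.

Lemma tensor_sq_proj_le s (X : tensor R n) :
  tensor_sq (tucker X (select_modes s)) <= tensor_sq X.
Proof.
by rewrite -[in leRHS](subrK (tucker X (select_modes s)) X) tensor_sq_proj lerDr tensor_sq_ge0.
Qed.

(* With [Q] the product of the first [m] projections and [P] the next one,
   [X - Q P X = (X - Q X) + Q (X - P X)] is an orthogonal sum. *)
Lemma tensor_sq_sub_proj_lt (X : tensor R n) (m : nat) : (m <= d)%N ->
  tensor_sq (X - tucker X (select_modes (fun k => (k < m)%N))) <=
    \sum_(j < d | (j < m)%N) tensor_sq (X - tucker X (select_modes (pred1 j))).
Proof.
elim: m => [_|m IHm m_lt].
  rewrite [in leLHS](_ : tucker _ _ = X); last by rewrite -tucker_id.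
  rewrite subrr big1 // /tensor_sq big1 // => i _.
  by rewrite ffunE normc0 expr0n.
pose j := Ordinal m_lt.
rewrite (bigD1 j) //=.
set Q := select_modes (fun k => (k < m)%N); set Pj := select_modes (pred1 j).
have -> : tucker X (select_modes (fun k => (k < m.+1)%N)) = tucker (tucker X Pj) Q.
  rewrite tucker_comp; apply: eq_tucker => k; rewrite /Q /Pj /select_modes /=.
  rewrite -val_eqE /= ltnS leq_eqVlt.
  by case: ltngtP => _ /=; rewrite ?mulmx1 ?mul1mx.
have -> : X - tucker (tucker X Pj) Q = X - tucker X Q + tucker (X - tucker X Pj) Q.
  by rewrite tuckerB addrA subrK.
rewrite tensor_sq_proj addrC lerD ?tensor_sq_proj_le //.
apply: le_trans (IHm (ltnW m_lt)) _; rewrite le_eqVlt; apply/orP; left; apply/eqP.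
by apply: eq_bigl => k; rewrite -val_eqE /= ltnS; case: ltngtP.
Qed.

Lemma tensor_sq_sub_proj (X : tensor R n) :
  tensor_sq (X - tucker X P) <=
    \sum_(j < d) tensor_sq (X - tucker X (select_modes (pred1 j))).
Proof.
have := tensor_sq_sub_proj_lt X (leqnn d).
rewrite (eq_bigl xpredT) => [|k]; last by rewrite ltn_ord.
by rewrite (@eq_tucker _ _ _ _ P) // => k; rewrite /select_modes ltn_ord.
Qed.

End ModeProjections.

(** * Mode products and matricizations *)

Lemma subst_index_eq n (i : multi_index n) (j : 'I_d) (a : 'I_(n j)) :
  subst_index i a j = a.
Proof. by rewrite ffunE dfwith_in. Qed.

Lemma subst_index_neq n (i : multi_index n) (j k : 'I_d) (a : 'I_(n j)) :
  k != j -> subst_index i a k = i k.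
Proof. by move=> kj; rewrite ffunE dfwith_out // eq_sym. Qed.

Lemma mode_prod_tucker n (X : tensor R n) (A : forall k, 'M[R[i]]_(n k)) (j : 'I_d) :
  mode_prod X j (A j) = tucker X (select_modes A (pred1 j)).
Proof.
apply/ffunP => i; rewrite tuckerE ffunE.
(* The identity factors kill every multi-index that differs from [i] outside mode [j]; the survivors
   are the [subst_index i b]. *)
pose off_j (a : multi_index n) := [forall k, (k != j) ==> (a k == i k)].
rewrite [RHS](bigID off_j) /= [X in _ + X]big1 ?addr0; last first.
  move=> a /forallPn[k]; rewrite negb_imply => /andP[kj ak].
  by rewrite (bigD1 k) //= /select_modes /= (negPf kj) mxE eq_sym (negPf ak) mul0r mulr0.
rewrite (reindex_onto (fun b => subst_index i b) (fun a : multi_index n => a j)) /=.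
  apply: eq_big => [b|b _].
    rewrite subst_index_eq eqxx andbT; apply/esym/forallP => k; apply/implyP => kj.
    by rewrite subst_index_neq.
  congr (_ * _); rewrite (bigD1 j) //= big1 ?mulr1.
    by rewrite /select_modes /= eqxx subst_index_eq.
  by move=> k kj; rewrite /select_modes /= (negPf kj) mxE subst_index_neq ?eqxx.
move=> a /forallP a_off; apply/ffunP => k.
have [->|kj] := eqVneq k j; first by rewrite subst_index_eq.
by rewrite subst_index_neq //; have /implyP/(_ kj)/eqP := a_off k.
Qed.

Definition rest_of n (j : 'I_d) (i : multi_index n) : rest_index n j :=
  [ffun k : {k : 'I_d | k != j} => i (val k)].

Lemma insert_index_eq n (j : 'I_d) (a : 'I_(n j)) (c : rest_index n j) :
  insert_index a c j = a.
Proof.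
rewrite ffunE; move: (boolP _) => jj; destruct jj as [jj|nj].
  exact: val_inj.
by exfalso; rewrite eqxx in nj.
Qed.

Lemma insert_index_neq n (j k : 'I_d) (kj : k != j) (a : 'I_(n j)) (c : rest_index n j) :
  insert_index a c k = c (exist _ k kj).
Proof.
rewrite ffunE; move: (boolP _) => kj'; destruct kj' as [kj'|kj'].
  by exfalso; rewrite kj' in kj.
by rewrite (bool_irrelevance kj kj').
Qed.

Lemma rest_ofK n (j : 'I_d) (i : multi_index n) : insert_index (i j) (rest_of j i) = i.
Proof.
apply/ffunP => k; have [->|kj] := eqVneq k j; first by rewrite insert_index_eq.
by rewrite (insert_index_neq kj) ffunE.
Qed.

Lemma insert_indexK n (j : 'I_d) (a : 'I_(n j)) (c : rest_index n j) :
  rest_of j (insert_index a c) = c.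
Proof. by apply/ffunP => -[k kj]; rewrite ffunE /= (insert_index_neq kj). Qed.

Lemma subst_insert_index n (j : 'I_d) (a b : 'I_(n j)) (c : rest_index n j) :
  subst_index (insert_index a c) b = insert_index b c.
Proof.
apply/ffunP => k; have [->|kj] := eqVneq k j.
  by rewrite subst_index_eq insert_index_eq.
by rewrite subst_index_neq // !(insert_index_neq kj).
Qed.

Lemma sum_insert_index (V : nmodType) n (j : 'I_d) (f : multi_index n -> V) :
  \sum_i f i = \sum_a \sum_c f (insert_index a (@enum_val (rest_index n j) predT c)).
Proof.
rewrite pair_bigA /=.
rewrite (reindex (fun ac : 'I_(n j) * 'I_#|{: rest_index n j}| =>
  insert_index ac.1 (enum_val ac.2))) //=.
exists (fun i : multi_index n => (i j, enum_rank (rest_of j i))) => [[a c] _|i _] /=.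
  by rewrite insert_index_eq insert_indexK enum_valK.
by rewrite enum_rankK rest_ofK.
Qed.

Lemma tensor_sq_matricization n (X : tensor R n) (j : 'I_d) :
  tensor_sq X = mxsq (matricization X j).
Proof.
rewrite /tensor_sq (sum_insert_index j); apply: eq_bigr => a _.
by apply: eq_bigr => c _; rewrite mxE.
Qed.

Lemma matricizationB n (X Y : tensor R n) (j : 'I_d) :
  matricization (X - Y) j = matricization X j - matricization Y j.
Proof. by apply/matrixP => a c; rewrite !mxE !ffunE. Qed.

Lemma matricization_mode_prod n (X : tensor R n) (j : 'I_d) (A : 'M[R[i]]_(n j)) :
  matricization (mode_prod X j A) j = A *m matricization X j.
Proof.
apply/matrixP => a c; rewrite !mxE ffunE; apply: eq_bigr => b _.
by rewrite !mxE subst_insert_index insert_index_eq mulrC.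
Qed.

(** The matricization becomes [U j *m matricization G j *m K], where [K] is the transposed Kronecker
    product of the other factors. The entry [a0] is a filler for position [j], which [K] never
    reads. *)
Lemma mlrank_tucker n (G : tensor R n) (U : forall k, 'M[R[i]]_(n k)) (j : 'I_d) :
  (0 < n j)%N -> (mlrank (tucker G U) j <= mlrank G j)%N.
Proof.
move=> nj_gt0; pose a0 := Ordinal nj_gt0.
pose ins a c := insert_index a (@enum_val (rest_index n j) predT c).
pose K := \matrix_(c', c) \prod_(k | k != j) U k (ins a0 c k) (ins a0 c' k).
have -> : mlrank (tucker G U) j = \rank (U j *m matricization G j *m K).
  congr (\rank _); apply/matrixP => a c; rewrite mxE tuckerE (sum_insert_index j).
  rewrite exchange_big mxE; apply: eq_bigr => c' _ /=; rewrite mxE mulr_suml.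
  apply: eq_bigr => b _; rewrite (bigD1 j) //= !insert_index_eq !mxE mulrA.
  congr (_ * _); first exact: mulrC.
  by apply: eq_bigr => k kj; rewrite /ins !(insert_index_neq kj).
by apply: leq_trans (mxrankM_maxl _ _) (mxrankM_maxr _ _).
Qed.

End TensorAlgebra.

(** * Diagonalization and assembly of the approximation *)

(** In the diagonal equation, isolating the index of mode [j] gives the form (al - be) x = g for the
    matricization, with minus the sum over the other modes as be. *)
Lemma mode_projection (R : realType) (d : nat) (n : 'I_d -> nat)
    (n_gt0 : forall k, (0 < n k)%N) (D : forall k, 'rV[R[i]]_(n k))
    (E F : 'I_d -> set R[i]) (c : R) (k : 'I_d -> nat) (X G : tensor R n) (j : 'I_d) :
    (forall a, E j (D j 0 a)) ->
    (forall i : multi_index n, F j (- \sum_(l | l != j) D l 0 (i l))) ->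
    0 <= c -> (zolotarev (k j) (E j) (F j) <= c%:E)%E ->
    (forall i : multi_index n, (\sum_l D l 0 (i l)) * X i = G i) ->
  exists (t : nat) (B : 'M[R[i]]_(n j, t)),
    [/\ (t <= k j * mlrank G j)%N, B^t* *m B = 1%:M &
      tensor_sq (X - mode_prod X j (B *m B^t* )) <= c ^+ 2 * tensor_sq X].
Proof.
move=> DE DF c_ge0 Zc XG; pose a0 := Ordinal (n_gt0 j).
pose ins a cc := insert_index a (@enum_val (rest_index n j) predT cc).
pose be cc := - \sum_(l | l != j) D l 0 (ins a0 cc l).
have [|t [B [tk BB Berr]]] := low_rank_proj_of_zolotarev
  (x := matricization X j) (g := matricization G j) DE (be := be)
  (fun cc => DF _) c_ge0 Zc.
  move=> a cc; rewrite opprK !mxE -XG [X in _ = X * _](bigD1 j) //= insert_index_eq.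
  congr ((_ + _) * _); apply: eq_bigr => l lj.
  by rewrite /ins !(insert_index_neq lj).
exists t, B; split=> //.
by rewrite !(tensor_sq_matricization _ j) matricizationB matricization_mode_prod.
Qed.

Theorem theorem4p5 (R : realType) (d : nat) (d_gt0 : (0 < d)%N)
    (n : 'I_d -> nat) (n_gt0 : forall k, (0 < n k)%N)
    (A : forall k : 'I_d, 'M[R[i]]_(n k)) (X G : tensor R n)
    (sylvester : \sum_(k < d) mode_prod X k (A k) = G)
    (A_normal : forall k, A k \is normalmx)
    (E F : 'I_d -> set R[i]) (A_separated : singly_separated_by A E F)
    (mu : 'I_d -> nat) (G_mlrank : mlrank G = mu)
    (eps : R) (eps_gt0 : 0 < eps) (eps_lt1 : eps < 1)
    (k : 'I_d -> nat)
    (k_zolotarev : forall j : 'I_d,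
      (zolotarev (k j) (E j) (F j) <= (eps / Num.sqrt d%:R)%:E)%E) :
  (pML eps_gt0 X <=
     \sum_(j < d) n j * k j * mu j + \prod_(j < d) (k j * mu j))%N.
Proof.
pose U l := spectralmx (A l); pose D l := spectral_diag (A l).
have UU l : U l *m (U l)^t* = 1%:M by apply/unitarymxP/spectral_unitarymx.
have UU' l : (U l)^t* *m U l = 1%:M by apply: mulmx1C.
have UA l : U l *m A l = diag_mx (D l) *m U l.
  have /orthomx_spectralP := A_normal l; rewrite -/(U l) -/(D l).
  rewrite invmx_unitary ?spectral_unitarymx // => {1}->.
  by rewrite !mulmxA UU mul1mx.
have D_eigen l (a : 'I_(n l)) : spectrum (A l) (D l 0 a).
  (* Rows of [U l] are eigenvectors, and unitarity makes them nonzero. *)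
  apply/eigenvalueP; exists (row a (U l)).
    by rewrite -row_mul UA row_mul row_diag_mx -scalemxAl -rowE.
  apply/eqP => Ua0; have := congr1 (fun M : 'M_(n l) => M a a) (UU l).
  rewrite !mxE eqxx big1 => [/eqP|b _]; first by rewrite eq_sym oner_eq0.
  by move/rowP/(_ b): Ua0; rewrite !mxE => ->; rewrite mul0r.
pose Xh := tucker X U; pose Gh := tucker G U.
(* By [UA], the change of basis turns each mode product by [A l] into one by [diag_mx (D l)], so the
   Sylvester equation becomes entrywise. *)
have XGh (i : multi_index n) : (\sum_l D l 0 (i l)) * Xh i = Gh i.
  rewrite /Gh -sylvester tucker_sum sum_ffunE mulr_suml; apply: eq_bigr => l _.
  rewrite mode_prod_tucker tucker_comp.
  transitivity (mode_prod Xh l (diag_mx (D l)) i).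
    rewrite [RHS]ffunE (bigD1 (i l)) //= big1 => [|a /negPf ai].
      rewrite addr0 mxE eqxx mulr1n mulrC; congr (Xh _ * _).
      apply/ffunP => l'; have [->|ll'] := eqVneq l' l; first by rewrite subst_index_eq.
      by rewrite subst_index_neq.
    by rewrite mxE eq_sym ai mulr0n mulr0.
  rewrite (@mode_prod_tucker _ _ _ _ (fun l => diag_mx (D l))) /Xh tucker_comp.
  congr (fun_of_fin _ i); apply: eq_tucker => l'; rewrite /select_modes /=.
  by case: eqP => _; rewrite ?mul1mx ?mulmx1.
have XE : X = tucker Xh (fun l => (U l)^t* ).
  by rewrite tucker_comp (eq_tucker _ UU') -tucker_id.
pose c := eps / Num.sqrt d%:R.
have c_ge0 : 0 <= c by rewrite divr_ge0 ?sqrtr_ge0 // ltW.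
have modeP j : exists (t : nat) (B : 'M[R[i]]_(n j, t)),
    [/\ (t <= k j * mu j)%N, B^t* *m B = 1%:M &
      tensor_sq (Xh - mode_prod Xh j (B *m B^t* )) <= c ^+ 2 * tensor_sq Xh].
  have [EF AE AF] := A_separated j.
  have [a|i|t [B [tk BB Berr]]] :=
    mode_projection n_gt0 (D := D) (E := E) (F := F) _ _ c_ge0 (k_zolotarev j) XGh.
  - exact/AE/D_eigen.
  - by apply: AF; exists (\sum_(l | l != j) D l 0 (i l)) => //; exists (fun l => D l 0 (i l)).
  (* The rank bound obtained is for [Gh]; a change of basis does not raise multilinear rank. *)
  exists t, B; split=> //; apply: leq_trans tk _.
  by rewrite leq_mul2l -G_mlrank mlrank_tucker ?orbT.
have [t /fin_all_exists[B tB]] := fin_all_exists modeP.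
have {modeP} [t_le BB Berr] : [/\ forall j, (t j <= k j * mu j)%N,
    forall j, (B j)^t* *m B j = 1%:M &
    forall j, tensor_sq (Xh - mode_prod Xh j (B j *m (B j)^t* )) <= c ^+ 2 * tensor_sq Xh].
  by split=> j; have [] := tB j.
pose P j := B j *m (B j)^t*.
have P_herm j : (P j)^t* = P j by rewrite /P trmx_mul map_mxM trmxCK.
have P_idem j : P j *m P j = P j.
  by rewrite /P mulmxA -[_ *m _ *m B j]mulmxA BB mulmx1.
pose V l := (U l)^t*.
have VV l : (V l)^t* *m V l = 1%:M by rewrite /V trmxCK.
(* The projected tensor in the original basis: its Tucker factors are [V l *m B l], and its core is
   [Xh] compressed by the adjoints of the [B l]. *)
pose Y := tucker (tucker Xh P) V.
have dof : approx_dof eps X (tucker_dof n t).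
  exists t, Y; split=> //.
    exists (fun l => V l *m B l), (tucker Xh (fun l => (B l)^t* )); split.
      move=> l; rewrite trmx_mul map_mxM -mulmxA [(V l)^t* *m _]mulmxA VV mul1mx.
      exact: BB.
    by rewrite /Y !tucker_comp; apply: eq_tucker => l; rewrite mulmxA.
  have sqX : tensor_sq X = tensor_sq Xh by rewrite XE tensor_sq_isometry.
  have : tensor_sq (X - Y) <= eps ^+ 2 * tensor_sq X.
    rewrite {1}XE -tuckerB tensor_sq_isometry // sqX.
    apply: le_trans (tensor_sq_sub_proj P_herm P_idem Xh) _.
    apply: le_trans (_ : \sum_(j < d) c ^+ 2 * tensor_sq Xh <= _).
      by apply: ler_sum => j _; rewrite -mode_prod_tucker.
    (* The [d] errors of eps^2 / d add up to eps^2; here [d] must be nonzero. *)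
    rewrite sumr_const card_ord -mulr_natl mulrA /c expr_div_n sqr_sqrtr ?ler0n //.
    by rewrite mulrCA divff ?mulr1 // pnatr_eq0 -lt0n.
  rewrite /frobenius -/(tensor_sq X) -/(tensor_sq (X - Y)) => le_sq.
  rewrite -[eps](ger0_norm (ltW eps_gt0)) -sqrtr_sqr -sqrtrM ?sqr_ge0 //.
  exact: ler_wsqrtr.
have : (pML eps_gt0 X <= tucker_dof n t)%N.
  by rewrite /pML; case: ex_minnP => m _; apply; apply/asboolP.
move/leq_trans; apply; apply: leq_add.
  by apply: leq_sum => j _; rewrite -mulnA leq_mul2l t_le orbT.
by apply: leq_prod => j _; apply: t_le.
Qed.
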